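(* Let $\Lambda$ be a finite dimensional algebra over a field, let $0\to A\to B\to C\to0$ be a short exact sequence in $\mathrm{mod}\,\Lambda$, let $k>1$ be an integer and $n$ a nonnegative integer. If $k\text{-}\operatorname{dell}B\le n$ and $(k-1)\text{-}\operatorname{edell}C\le n+1$, then $k\text{-}\operatorname{edell}A\le n$.
   Context: $\mathrm{mod}\,\Lambda$ is the category of finitely generated right $\Lambda$-modules. $\mathbb N$ is the set of nonnegative integers; the infimum of the empty set is $+\infty$. $\Omega M$ is the kernel of a projective cover of $M$, $\Omega^0M=M$, $\Omega^{n+1}M=\Omega(\Omega^nM)$. ''$U$ is a direct summand of $V$ up to projective summands'' means that $U$ is isomorphic to a direct summand of $V\oplus P$ for some projective $P$. For an integer $k\ge1$: $k\text{-}\operatorname{dell}M$ is the infimum of all $n\in\mathbb N$ such that $\Omega^nM$ is a direct summand of $\Omega^{n+k}N$ up to projective summands for some $N\in\mathrm{mod}\,\Lambda$; and $k\text{-}\operatorname{edell}M$ is the infimum of all $n\in\mathbb N$ such that for every integer $k'\ge1$ and every right $\Lambda$-module $X$ of injective dimension $\mathrm{id}\,X=n+k-1+k'$ one has $\mathrm{Ext}_\Lambda^{n+k'}(M,X)=0$. *)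

(* Defs.v *)
From HB Require Import structures.
From mathcomp Require Import all_boot all_order all_algebra all_field.
From mathcomp Require Import boolp constructive_ereal.

Set Implicit Arguments.
Unset Strict Implicit.
Unset Printing Implicit Defensive.

Import Order.TTheory GRing.Theory Num.Theory.
Local Open Scope ring_scope.

(* The homological notions are developed for left modules over a ring R; they *)
(* are used at the converse ring R := L^c of an algebra L, and a left module  *)
(* over L^c is a right module over L: (a * b : L^c) is the product b * a of L.*)
Notation rmodType L := (lmodType (L^c)%type).

(* Infimum in {0, 1, 2, ..., +oo}, realised inside \bar int. *)
Definition natinf (S : nat -> Prop) : \bar int :=
  if pselect (exists n, `[< S n >]) is left exS then
    ((ex_minn exS)%:Z)%:E%E
  else +oo%E.

Section Modules.
Variable R : pzRingType.
Implicit Types M N K L X U V W P : lmodType R.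

Definition finitely_generated M : Prop :=
  exists s : seq M, forall x : M,
    exists a : nat -> R, x = \sum_(i < size s) a i *: s`_i.

Definition linear_iso U V : Prop := exists f : {linear U -> V}, bijective f.

Definition epi U V (f : {linear U -> V}) : Prop := forall y, exists x, y = f x.

Definition exact U V W (f : {linear U -> V}) (g : {linear V -> W}) : Prop :=
  forall y, g y = 0 <-> exists x, y = f x.

Definition short_exact U V W (f : {linear U -> V}) (g : {linear V -> W}) :
  Prop := [/\ injective f, exact f g & epi g].

Definition projective P : Prop :=
  forall M N (g : {linear M -> N}) (f : {linear P -> N}), epi g ->
    exists h : {linear P -> M}, forall x, g (h x) = f x.

Definition injective_module X : Prop :=
  forall M N (g : {linear M -> N}) (f : {linear M -> X}), injective g ->
    exists h : {linear N -> X}, forall x, h (g x) = f x.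

Definition superfluous_kernel P M (p : {linear P -> M}) : Prop :=
  forall S : {pred P}, submod_closed S ->
    (forall x, exists2 s, s \in S & exists2 y, p y = 0 & x = s + y) ->
    forall x, x \in S.

Definition projective_cover P M (p : {linear P -> M}) : Prop :=
  [/\ projective P, epi p & superfluous_kernel p].

(* K is (isomorphic to) the kernel of a projective cover of M. *)
Definition is_syzygy M K : Prop :=
  exists P (i : {linear K -> P}) (p : {linear P -> M}),
    projective_cover p /\ short_exact i p.

(* Syzygies are defined up to isomorphism only, hence a relation: K is        *)
(* (isomorphic to) the n-th syzygy of M.                                      *)
Fixpoint is_nsyzygy (n : nat) M K : Prop :=
  if n is m.+1 then exists2 L, is_nsyzygy m M L & is_syzygy L K
  else linear_iso M K.

Definition summand_up_to_projective U V : Prop :=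
  exists P W, projective P /\ linear_iso (U * W)%type (V * P)%type.

Record proj_resolution M := ProjResolution {
  pres_mod :> nat -> lmodType R;
  pres_d : forall i, {linear pres_mod i.+1 -> pres_mod i};
  pres_aug : {linear pres_mod 0%N -> M};
  pres_proj : forall i, projective (pres_mod i);
  pres_epi : epi pres_aug;
  pres_exact0 : exact (pres_d 0) pres_aug;
  pres_exact : forall i, exact (pres_d i.+1) (pres_d i)
}.

Record inj_resolution X := InjResolution {
  ires_mod :> nat -> lmodType R;
  ires_d : forall i, {linear ires_mod i -> ires_mod i.+1};
  ires_coaug : {linear X -> ires_mod 0%N};
  ires_inj : forall i, injective_module (ires_mod i);
  ires_mono : injective ires_coaug;
  ires_exact0 : exact ires_coaug (ires_d 0);
  ires_exact : forall i, exact (ires_d i) (ires_d i.+1)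
}.

Section Ext.
Variables (M X : lmodType R) (P : proj_resolution M).

Definition cocycle n (f : {linear P n -> X}) : Prop :=
  forall x, f (pres_d P n x) = 0.

Definition coboundary n : {linear P n -> X} -> Prop :=
  match n with
  | 0 => fun f => forall x, f x = 0
  | m.+1 => fun f =>
      exists g : {linear P m -> X}, forall x, f x = g (pres_d P m x)
  end.

End Ext.

(* Ext^n(M, X) = 0, i.e. H^n(Hom(P, X)) = 0 for a projective resolution P of  *)
(* M; the choice of P is irrelevant.                                          *)
Definition Ext_eq0 n M X : Prop :=
  exists P : proj_resolution M,
    forall f : {linear P n -> X}, cocycle f -> coboundary f.

Definition injdim X : \bar int :=
  natinf (fun n => exists I : inj_resolution X,
    forall j, (n < j)%N -> forall x : I j, x = 0).

Definition dell (k : nat) M : \bar int :=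
  natinf (fun n => exists N K L,
    [/\ finitely_generated N, is_nsyzygy n M K, is_nsyzygy (n + k) N L
      & summand_up_to_projective K L]).

Definition edell (k : nat) M : \bar int :=
  natinf (fun n => forall k' : nat, (1 <= k')%N -> forall X,
    injdim X = ((n + k - 1 + k')%N%:Z)%:E%E -> Ext_eq0 (n + k') M X).

End Modules.

(* Main.v *)
(* If id X = n + k - 1 + k', the half-exact sequence
     Ext^(n+k')(B, X) -> Ext^(n+k')(A, X) -> Ext^(n+k'+1)(C, X)
   has a zero last term because (k-1)-edell C <= n+1. If Omega^m B with
   m <= n is stably a summand of Omega^(m+k) N, then by dimension shifting the
   first term is a summand of Ext^(n+k+k')(N, X), which is zero because its
   degree exceeds id X. Ext is computed from an injective resolution of X, which makes
   half-exactness and vanishing above id X immediate; the comparison with a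
   projective resolution P of M goes by induction on the degree, along
   0 -> ker -> P_0 -> M -> 0. *)
Require Import Defs.
From HB Require Import structures.
From mathcomp Require Import all_boot all_order all_algebra all_field.
From mathcomp Require Import boolp constructive_ereal zify.
From mathcomp Require freeg.

Set Implicit Arguments.
Unset Strict Implicit.
Unset Printing Implicit Defensive.

Import Order.TTheory GRing.Theory Num.Theory.
Local Open Scope ring_scope.

Section Kernel.
Variables (R : pzRingType) (U V : lmodType R) (f : {linear U -> V}).

Definition in_kernel : {pred U} := [pred x | f x == 0].

Fact in_kernel_submod_closed : submod_closed in_kernel.
Proof.
split=> [|a x y]; rewrite !inE ?linear0 // => /eqP fx0 /eqP fy0.
by rewrite linearP fx0 fy0 scaler0 addr0.
Qed.
HB.instance Definition _ :=
  GRing.isSubmodClosed.Build R U in_kernel in_kernel_submod_closed.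

Record kernel := Kernel { kernel_val : U; _ : kernel_val \in in_kernel }.
HB.instance Definition _ := [isSub for kernel_val].
HB.instance Definition _ := [Choice of kernel by <:].
HB.instance Definition _ := [SubChoice_isSubLmodule of kernel by <:].

Definition kernel_incl : {linear kernel -> U} := (val : kernel -> U).
End Kernel.

Section LinearMaps.
Variable R : pzRingType.
Implicit Types A B C P U V W : lmodType R.

Lemma linear_map_of U V (f : U -> V) :
  linear f -> exists g : {linear U -> V}, g =1 f.
Proof.
move=> lin_f; pose L := GRing.isLinear.Build R U V *:%R f lin_f.
by pose g : {linear U -> V} := HB.pack f L; exists g.
Qed.

Lemma factor_through_epi U V W (p : {linear U -> V}) (f : {linear U -> W}) :
  epi p -> (forall x, p x = 0 -> f x = 0) ->
  exists g : {linear V -> W}, forall x, g (p x) = f x.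
Proof.
move=> p_epi kerpf; pose s y := projT1 (cid (p_epi y)).
have sK y : p (s y) = y by rewrite /s; case: cid.
have fs x : f (s (p x)) = f x.
  by apply/eqP; rewrite -subr_eq0 -linearB kerpf // linearB sK subrr.
have [|g gE] := @linear_map_of V W (f \o s); last first.
  by exists g => x; rewrite gE /= fs.
by move=> a x y /=; rewrite -linearP -{1}[x]sK -{1}[y]sK -linearP fs.
Qed.

Lemma factor_through_mono U V W (i : {linear U -> V}) (f : {linear W -> V}) :
  injective i -> (forall x, exists y, f x = i y) ->
  exists g : {linear W -> U}, forall x, i (g x) = f x.
Proof.
move=> i_inj fi; pose s x := projT1 (cid (fi x)).
have sK x : i (s x) = f x by rewrite /s; case: cid.
have [|g gE] := @linear_map_of W U s; last by exists g => x; rewrite gE.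
by move=> a x y; apply: i_inj; rewrite linearP !sK linearP.
Qed.

Lemma linear_iso_inv U V : linear_iso U V ->
  exists f : {linear U -> V}, exists g : {linear V -> U},
    cancel f g /\ cancel g f.
Proof.
case=> f [g fK gK]; have [|h hE] := @linear_map_of V U g.
  by move=> a x y; apply: (can_inj fK); rewrite linearP !gK.
by exists f, h; split=> x; rewrite hE.
Qed.

Lemma kernel_inclP U V (f : {linear U -> V}) y :
  f y = 0 <-> exists x, y = kernel_incl f x.
Proof.
split=> [fy0|[x ->]]; last exact/eqP/(valP x).
have fy : y \in in_kernel f by rewrite inE fy0.
by exists (Kernel fy).
Qed.

Lemma short_exact_kernel U V (f : {linear U -> V}) :
  epi f -> short_exact (kernel_incl f) f.
Proof.
move=> f_epi; split; [exact: val_inj | exact: kernel_inclP | exact: f_epi].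
Qed.

Lemma short_exact_comp0 A B C (i : {linear A -> B}) (p : {linear B -> C}) :
  short_exact i p -> forall x, p (i x) = 0.
Proof. by case=> _ ex _ x; apply/ex; exists x. Qed.

Lemma kernel_corestrict U V W (f : {linear U -> V}) (g : {linear V -> W}) :
  exact f g -> exists q : {linear U -> kernel g},
    epi q /\ forall x, kernel_incl g (q x) = f x.
Proof.
move=> ex; have [|x|q qE] := @factor_through_mono _ _ _ (kernel_incl g) f.
- exact: val_inj.
- by apply/kernel_inclP/ex; exists x.
exists q; split=> // y; have /ex[x yE] : g (kernel_incl g y) = 0.
  by apply/kernel_inclP; exists y.
by exists x; apply: val_inj; rewrite /= -[LHS]/(kernel_incl g y) yE -qE.
Qed.

Lemma projective_lift P U V W (f : {linear U -> V}) (g : {linear V -> W})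
    (h : {linear P -> V}) :
  projective P -> exact f g -> (forall x, g (h x) = 0) ->
  exists h' : {linear P -> U}, forall x, f (h' x) = h x.
Proof.
move=> projP ex gh; have [q [q_epi qE]] := kernel_corestrict ex.
have [|x|h1 h1E] := @factor_through_mono _ _ _ (kernel_incl g) h.
- exact: val_inj.
- exact/kernel_inclP.
have [h' h'E] := projP _ _ q h1 q_epi.
by exists h' => x; rewrite -qE h'E h1E.
Qed.
End LinearMaps.
Arguments factor_through_epi {R U V W p} f.
Arguments factor_through_mono {R U V W i} f.

Section CosyzygyExt.
Variables (R : pzRingType) (X : lmodType R) (I : inj_resolution X).
Implicit Types A B C K L M N P V W : lmodType R.

(* Note the shift: [ext_vanish j M] means Ext^(j+1)(M, X) = 0. *)
Definition ext_vanish (j : nat) M : Prop :=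
  forall f : {linear M -> I j.+1}, (forall x, ires_d I j.+1 (f x) = 0) ->
    exists g : {linear M -> I j}, forall x, f x = ires_d I j (g x).

Lemma ires_d0 j x : ires_d I j.+1 (ires_d I j x) = 0.
Proof. by apply/ires_exact; exists x. Qed.

Lemma ires_coaug0 x : ires_d I 0 (ires_coaug I x) = 0.
Proof. by apply/ires_exact0; exists x. Qed.

Lemma projective_ext_vanish P j : projective P -> ext_vanish j P.
Proof.
move=> projP f df0.
have [g gE] := projective_lift projP (@ires_exact _ _ I j) df0.
by exists g => x; rewrite gE.
Qed.

Lemma ext_vanish_retract M N (s : {linear M -> N}) (r : {linear N -> M}) j :
  cancel s r -> ext_vanish j N -> ext_vanish j M.
Proof.
move=> sK vN f df0; have [|g gE] := vN (f \o r : {linear N -> _}).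
  by move=> x; apply: df0.
by exists (g \o s : {linear M -> _}) => x; rewrite /= -gE /= sK.
Qed.

Lemma ext_vanish_iso M N j : linear_iso M N ->
  ext_vanish j M <-> ext_vanish j N.
Proof.
by case/linear_iso_inv=> f [g [fK gK]]; split; apply: ext_vanish_retract.
Qed.

Lemma ext_vanish_prod M N j :
  ext_vanish j M -> ext_vanish j N -> ext_vanish j (M * N)%type.
Proof.
move=> vM vN f df0.
have [|iM iME] := @linear_map_of _ M (M * N)%type (fun x => (x, 0)).
  by move=> a x y; congr pair; rewrite /= ?scaler0 ?addr0.
have [|iN iNE] := @linear_map_of _ N (M * N)%type (fun y => (0, y)).
  by move=> a x y; congr pair; rewrite /= ?scaler0 ?addr0.
have [x|g gE] := vM (f \o iM : {linear M -> _}); first exact: df0.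
have [x|h hE] := vN (f \o iN : {linear N -> _}); first exact: df0.
exists ((g \o fst) \+ (h \o snd) : {linear (M * N)%type -> _}) => -[x y] /=.
rewrite linearD -gE -hE /= iME iNE -linearD; congr (f _).
by congr pair; rewrite /= ?addr0 ?add0r.
Qed.

Lemma ext_vanish_summand U V j :
  summand_up_to_projective U V -> ext_vanish j V -> ext_vanish j U.
Proof.
move=> [P [W [projP iso]]] vV.
have vUW : ext_vanish j (U * W)%type.
  by apply/(ext_vanish_iso _ iso)/ext_vanish_prod/projective_ext_vanish.
have [|iU iUE] := @linear_map_of _ U (U * W)%type (fun x => (x, 0)).
  by move=> a x y; congr pair; rewrite /= ?scaler0 ?addr0.
apply: (@ext_vanish_retract _ _ iU (fst : {linear (U * W)%type -> U})) => //.
by move=> x; rewrite iUE.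
Qed.

Section ShortExact.
Variables (A B C : lmodType R) (i : {linear A -> B}) (p : {linear B -> C}).
Hypothesis exABC : short_exact i p.

Lemma ext_vanish_sub j :
  ext_vanish j B -> ext_vanish j.+1 C -> ext_vanish j A.
Proof.
have pi0 := short_exact_comp0 exABC; case: exABC => i_inj ex p_epi vB vC f df0.
have [g gE] := ires_inj f i_inj.
have [x px0|h hE] := factor_through_epi (ires_d I j.+1 \o g) p_epi.
  by have /ex[y ->] := px0; rewrite /= gE.
have [c|u uE] := vC h.
  by have [b ->] := p_epi c; rewrite hE ires_d0.
have [b|w wE] := vB (g \- (u \o p) : {linear B -> _}).
  by rewrite /= linearB -uE hE subrr.
exists (w \o i : {linear A -> _}) => x /=.
by rewrite -wE /= pi0 gE linear0 subr0.
Qed.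

Lemma ext_vanish_quotient j :
  ext_vanish j A -> ext_vanish j.+1 B -> ext_vanish j.+1 C.
Proof.
have pi0 := short_exact_comp0 exABC; case: exABC => i_inj ex p_epi vA vB h dh0.
have [x|v vE] := vB (h \o p : {linear B -> _}); first exact: dh0.
have [x|w wE] := vA (v \o i : {linear A -> _}).
  by rewrite /= -vE /= pi0 linear0.
have [w' w'E] := ires_inj w i_inj.
have [x px0|u uE] :=
    factor_through_epi (v \- (ires_d I j \o w') : {linear B -> _}) p_epi.
  by have /ex[y ->] := px0; rewrite /= w'E -wE subrr.
exists u => c; have [b ->] := p_epi c.
by rewrite uE /= linearB ires_d0 subr0 -vE.
Qed.
End ShortExact.

Lemma ext_vanish_shift K P M (i : {linear K -> P}) (p : {linear P -> M}) j :
  projective P -> short_exact i p -> ext_vanish j.+1 M <-> ext_vanish j K.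
Proof.
move=> projP exKPM; split=> [vM|vK].
  exact/(ext_vanish_sub exKPM)/vM/projective_ext_vanish.
exact/(ext_vanish_quotient exKPM vK)/projective_ext_vanish.
Qed.

Lemma ext_vanish_nsyzygy m M K j :
  is_nsyzygy m M K -> ext_vanish (j + m) M <-> ext_vanish j K.
Proof.
elim: m K j => [|m IH] K j /=; first by rewrite addn0; apply: ext_vanish_iso.
case=> L ML [P [i [p [[projP _ _] exKPL]]]].
by rewrite addnS -addSn (IH _ _ ML); apply: ext_vanish_shift exKPL.
Qed.

Lemma ext_vanish_resolution M (P : proj_resolution M) j :
  ext_vanish j M <->
  forall f : {linear P j.+1 -> X}, cocycle f -> coboundary f.
Proof.
elim: j M P => [|j IH] M P.
  have aug0 x : pres_aug P (pres_d P 0 x) = 0.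
    by apply/pres_exact0; exists x.
  split=> [vM f fd0|vP u du0].
    have [q [q_epi qE]] := kernel_corestrict (@pres_exact0 _ _ P).
    have [x qx0|f' f'E] := factor_through_epi f q_epi.
      have /pres_exact[y ->] : pres_d P 0 x = 0 by rewrite -qE qx0 linear0.
      exact: fd0.
    have [v vE] :=
      ires_inj (ires_coaug I \o f') (@val_inj _ _ _ : injective (kernel_incl _)).
    have [x /kernel_inclP[y ->]|u uE] :=
        factor_through_epi (ires_d I 0 \o v) (pres_epi P).
      by rewrite /= vE ires_coaug0.
    have [m|w wE] := vM u.
      by have [x ->] := pres_epi P m; rewrite uE ires_d0.
    have [x|g gE] := factor_through_mono
        (v \- (w \o pres_aug P) : {linear P 0 -> _}) (@ires_mono _ _ I).
      by apply/ires_exact0; rewrite /= linearB -wE uE subrr.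
    exists g => x; apply: (@ires_mono _ _ I).
    by rewrite gE /= aug0 linear0 subr0 -qE vE /= f'E.
  have [v vE] := projective_lift (h := u \o pres_aug P : {linear P 0 -> _})
    (@pres_proj _ _ P 0) (@ires_exact _ _ I 0) (fun x => du0 _).
  have [x|f fE] := factor_through_mono
      (v \o pres_d P 0 : {linear P 1 -> _}) (@ires_mono _ _ I).
    by apply/ires_exact0; rewrite /= vE /= aug0 linear0.
  have [x|g gE] := vP f.
    apply: (@ires_mono _ _ I); rewrite fE linear0 /=.
    have -> : pres_d P 0 (pres_d P 1 x) = 0 by apply/pres_exact; exists x.
    exact: linear0.
  have [x /pres_exact0[y ->]|w wE] := factor_through_epi
      (v \- (ires_coaug I \o g) : {linear P 0 -> _}) (pres_epi P).
    by rewrite /= -gE fE subrr.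
  exists w => m; have [x ->] := pres_epi P m.
  by rewrite wE /= linearB ires_coaug0 subr0 vE.
have [q [q_epi qE]] := kernel_corestrict (@pres_exact0 _ _ P).
have qex : exact (pres_d P 1) q.
  move=> y; split=> [qy0|yd].
    by apply/pres_exact; rewrite -qE qy0 linear0.
  by apply: val_inj; rewrite /= -[LHS]/(kernel_incl _ _) qE; apply/pres_exact.
pose P' := @ProjResolution _ (kernel (pres_aug P)) (fun i => P i.+1)
  (fun i => pres_d P i.+1) q (fun i => @pres_proj _ _ P i.+1) q_epi qex
  (fun i => @pres_exact _ _ P i.+1).
rewrite (ext_vanish_shift j (@pres_proj _ _ P 0)
  (short_exact_kernel (pres_epi P))).
exact: (IH _ P').
Qed.

End CosyzygyExt.

Section FreeModule.
Variable R : nzRingType.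
Implicit Types M N : lmodType R.
Import freeg.

Definition free M : lmodType R := {freeg M / R}.

Section Lift.
Variables (M N : lmodType R) (f : M -> N).

HB.instance Definition _ := GRing.isZmodMorphism.Build {freeg M / R} N
  (fglift f) (lift_is_additive f).

Lemma fglift_scalable a (D : {freeg M / R}) :
  fglift f (a *: D) = a *: fglift f D.
Proof.
rewrite -[in RHS](freeg_sumE D) [a *: D]/(fgscale a D) !raddf_sum.
by apply: eq_bigr => x _ /=; rewrite !liftU scalerA.
Qed.

HB.instance Definition _ := GRing.isScalable.Build R {freeg M / R} N *:%R
  (fglift f) fglift_scalable.

Definition free_lift : {linear free M -> N} := fglift f.

Lemma free_liftE x : free_lift << 1 *g x >> = f x.
Proof. by rewrite /free_lift /= liftU scale1r. Qed.
End Lift.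

Lemma free_ext M N (f g : {linear free M -> N}) :
  (forall x, f << 1 *g x >> = g << 1 *g x >>) -> f =1 g.
Proof.
move=> fg D; rewrite -(freeg_sumE D) !linear_sum; apply: eq_bigr => x _.
have -> : << coeff x D *g x >> = coeff x D *: (<< 1 *g x >> : {freeg M / R}).
  by apply/eqP/freeg_eqP=> y; rewrite coeffZ !coeffU mul1r.
by rewrite !linearZ fg.
Qed.

Lemma free_projective M : projective (free M).
Proof.
move=> N L g f g_epi; pose s x := projT1 (cid (g_epi (f << 1 *g x >>))).
exists (free_lift s) => D.
apply: (@free_ext _ _ (g \o free_lift s : {linear free M -> L})) => x.
by rewrite /= free_liftE /s; case: cid.
Qed.

Definition free_aug M : {linear free M -> M} := free_lift idfun.

Lemma free_aug_epi M : epi (free_aug M).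
Proof. by move=> x; exists << 1 *g x >>; rewrite free_liftE. Qed.

Fixpoint free_syzygy M n : lmodType R :=
  if n is m.+1 then kernel (free_aug (free_syzygy M m)) else M.

Lemma free_resolution M : inhabited (proj_resolution M).
Proof.
pose Z := free_syzygy M.
pose d n : {linear free (Z n.+1) -> free (Z n)} :=
  kernel_incl (free_aug (Z n)) \o free_aug (Z n.+1).
have d_im n y : free_aug (Z n) y = 0 <-> exists x, y = d n x.
  split=> [/kernel_inclP[z ->]|[x ->]]; last by apply/kernel_inclP; eexists.
  by have [x ->] := free_aug_epi z; exists x.
constructor; apply: (@ProjResolution _ M (fun n => free (Z n)) d (free_aug M)).
- by move=> n; apply: free_projective.
- exact: free_aug_epi.
- exact: d_im.
- move=> n y; rewrite -d_im; split=> [dy0|y0]; last first.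
    by rewrite -[d n y]/(kernel_incl _ (free_aug _ y)) y0 linear0.
  by apply: val_inj; rewrite [RHS]linear0.
Qed.
End FreeModule.

Section Infimum.
Implicit Types (S : nat -> Prop) (n : nat).

Lemma natinf_le S n : (natinf S <= n%:Z%:E)%E -> exists2 m, (m <= n)%N & S m.
Proof.
rewrite /natinf; case: pselect => // ex; case: ex_minnP => m /asboolP Sm _.
by rewrite lee_fin lez_nat => mn; exists m.
Qed.

Lemma le_natinf S n : S n -> (natinf S <= n%:Z%:E)%E.
Proof.
move=> Sn; rewrite /natinf; case: pselect => [ex|[]]; last first.
  by exists n; apply/asboolP.
case: ex_minnP => m _ min_m.
by rewrite lee_fin lez_nat; apply: min_m; apply/asboolP.
Qed.
End Infimum.

Section Delooping.
Variable R : pzRingType.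
Implicit Types M X : lmodType R.

Lemma injdim_resolution X n : injdim X = n%:Z%:E%E ->
  exists I : inj_resolution X, forall j, (n < j)%N -> forall x : I j, x = 0.
Proof.
move=> idX.
have /natinf_le[m mn [I I0]] : (injdim X <= n%:Z%:E)%E by rewrite idX.
by exists I => j /(leq_ltn_trans mn); apply: I0.
Qed.

Lemma ext_vanish_large X (I : inj_resolution X) M j :
  (forall x : I j.+1, x = 0) -> ext_vanish I j M.
Proof.
move=> I0 f _; have [|g gE] := @linear_map_of _ M (I j) (fun=> 0).
  by move=> a x y; rewrite scaler0 addr0.
by exists g => x; rewrite (I0 (f x)) [RHS]I0.
Qed.

Lemma dell_ext_vanish k n j M X (I : inj_resolution X) :
  (dell k M <= n%:Z%:E)%E ->
  (forall i, (n + k + j < i)%N -> forall x : I i, x = 0) ->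
  ext_vanish I (n + j) M.
Proof.
move=> /natinf_le[m mn [N [K [L [_ MK NL KL]]]]] I0.
have -> : (n + j = (n - m + j) + m)%N by rewrite addnAC subnK.
apply/(ext_vanish_nsyzygy I _ MK)/(ext_vanish_summand KL).
apply/(ext_vanish_nsyzygy I _ NL)/ext_vanish_large/I0.
lia.
Qed.

Lemma edell_Ext_eq0 k n k' M X : (edell k M <= n%:Z%:E)%E ->
  (0 < k)%N -> (0 < k')%N -> injdim X = (n + k - 1 + k')%N%:Z%:E%E ->
  Ext_eq0 (n + k') M X.
Proof.
move=> /natinf_le[m mn Sm] k0 k'0 idX.
have -> : (n + k' = m + (n - m + k'))%N by rewrite addnA subnKC.
apply: Sm; first by rewrite addn_gt0 k'0 orbT.
by rewrite idX; congr (Posz _)%:E%E; lia.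
Qed.
End Delooping.

Theorem lemma2p21 (F : fieldType) (Lam : falgType F) (A B C : rmodType Lam)
    (fgA : finitely_generated A) (fgB : finitely_generated B)
    (fgC : finitely_generated C)
    (i : {linear A -> B}) (p : {linear B -> C}) (exABC : short_exact i p)
    (k n : nat) (hk : (1 < k)%N) :
  (dell k B <= n%:Z%:E)%E -> (edell (k - 1) C <= n.+1%:Z%:E)%E ->
  (edell k A <= n%:Z%:E)%E.
Proof.
move=> dellB edellC; apply: le_natinf => -[//|j] _ X idX.
have [I I0] := injdim_resolution idX.
have [P] := free_resolution A; exists P.
rewrite addnS; apply/(ext_vanish_resolution I P).
apply: (ext_vanish_sub exABC).
  by apply: (dell_ext_vanish dellB) => m nm; apply: I0; lia.
have [Q] : Ext_eq0 (n + j).+2 C X.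
  rewrite -addnS -addSn; apply: (edell_Ext_eq0 edellC) => //.
    by rewrite subn_gt0.
  by rewrite idX; congr (Posz _)%:E%E; lia.
by move/(ext_vanish_resolution I Q).
Qed.
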